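(* Fix an integer $T\ge 1$ and reals $\eta>0$, $\ell>0$, $\Delta>0$ with $\eta\ell\ge 5$. There exist an $\ell$-smooth function $f:\mathbb{R}\to\mathbb{R}$ with minimum value $f^*$ and an initial point $x_0$ with $f(x_0)-f^*\le\Delta$ such that, if we run Gradient Descent $x_{t+1}=x_t-\eta_t\nabla f(x_t)$ with stepsize $\eta_t=\frac{\eta}{\sqrt{t+1}}$, then with $t_0=\lfloor \eta^2\ell^2/16-1\rfloor$ the following hold. For $1\le t\le t_0$, $$|\nabla f(x_t)|\ge\sqrt{\frac{2\ell\Delta}{3\sqrt{t}}}\,(8e)^{t/2},$$ and $$|\nabla f(x_{t_0})|\ge\sqrt{\frac{8\Delta}{3\eta}}\,(8e)^{\eta^2\ell^2/32-4}.$$ If $T>t_0$, then there is a number $\tilde\Delta\ge\frac{4}{3\eta\ell}(8e)^{\eta^2\ell^2/16-2}\Delta$ such that for all $t_0<t\le T$, $$|\nabla f(x_t)|\ge\frac14\sqrt{\tilde\Delta}\,\min\left\{\ell^{1/2},\,(2\eta)^{-1/2}T^{-1/4}\right\}.$$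
   Context: A function $f:\mathbb{R}\to\mathbb{R}$ is $\ell$-smooth if it is differentiable and $|\nabla f(x_1)-\nabla f(x_2)|\le\ell|x_1-x_2|$ for all $x_1,x_2\in\mathbb{R}$; here $\nabla f=f'$. *)

(* Defs.v *)
From Stdlib Require Import Reals ZArith.
From Coquelicot Require Import Coquelicot.
Open Scope R_scope.

(* [Derive] is total, so differentiability is required separately. *)
Definition smooth (l : R) (f : R -> R) : Prop :=
  (forall x : R, ex_derive f x) /\
  (forall x1 x2 : R, Rabs (Derive f x1 - Derive f x2) <= l * Rabs (x1 - x2)).

Definition is_min_value (f : R -> R) (m : R) : Prop :=
  (exists x : R, f x = m) /\ (forall x : R, m <= f x).

Fixpoint gradient_descent (f : R -> R) (step : nat -> R) (x0 : R) (t : nat) : R :=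
  match t with
  | O => x0
  | S s =>
      gradient_descent f step x0 s
      - step s * Derive f (gradient_descent f step x0 s)
  end.

(* [Int_part] is the floor of a real. [Z.to_nat] sends negative integers to 0,
   which loses nothing when [eta * l >= 5]: the real below is then positive. *)
Definition threshold (eta l : R) : nat :=
  Z.to_nat (Int_part (eta ^ 2 * l ^ 2 / 16 - 1)).

(* Main.v *)
Require Import Defs.
From Stdlib Require Import Reals ZArith.
From Coquelicot Require Import Coquelicot.
From Stdlib Require Import Lra Lia.
Open Scope R_scope.

(** Write a = eta l and t0 = floor(a^2/16 - 1). While the iterates stay where
    f(x) = l x^2 / 2, a step multiplies x by 1 - a / sqrt(t+1), whose absolute value
    is at least (3/4) a / sqrt(t+1) for t < t0; hence |x_t| is at least
    |x_0| (3a/4)^t / sqrt(t!), and Stirling-type bounds give the exponential growth.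
    The sign of x_0 is chosen so that x_{t0} = - rho < 0, and the next iterate lies
    in [3 rho, 5 rho], a region no earlier iterate has visited. There f has passed a
    maximum at 2 rho and decreases with constant slope - l c, away from its
    minimizer 0, until a point M that the T-th iterate does not pass; beyond M it
    flattens out. The total displacement on the slope is at most 2 l c eta sqrt T,
    so c of order rho / sqrt(a sqrt T) keeps f nonnegative. *)

(** * The piecewise linear gradient profile and its Lipschitz bound *)

Lemma Rmin_dist (d a b a' b' : R) :
  Rabs (a - a') <= d -> Rabs (b - b') <= d -> Rabs (Rmin a b - Rmin a' b') <= d.
Proof.
  unfold Rmin; intros H1 H2; apply Rabs_le_between in H1, H2.
  apply Rabs_le_between.
  destruct (Rle_dec a b), (Rle_dec a' b'); lra.
Qed.

Lemma Rmax_dist (d a b a' b' : R) :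
  Rabs (a - a') <= d -> Rabs (b - b') <= d -> Rabs (Rmax a b - Rmax a' b') <= d.
Proof.
  unfold Rmax; intros H1 H2; apply Rabs_le_between in H1, H2.
  apply Rabs_le_between.
  destruct (Rle_dec a b), (Rle_dec a' b'); lra.
Qed.

(* On y >= 0, for c <= rho and 2 rho + c <= M: slope 1 up to rho, slope -1 down to
   the value - c, constant - c up to M, slope 1 up to M + c, then 0. It is the
   identity on y <= 0. *)
Definition profile (rho c M y : R) : R :=
  Rmin y (Rmax (2 * rho - y) (Rmin 0 (Rmax (- c) (y - M - c)))).

(** Every branch is constant or has slope 1 or -1 in [y], and minima and maxima preserve a common
    bound on differences. This becomes the smoothness of the objective. *)
Lemma profile_lipschitz (rho c M x y : R) :
  Rabs (profile rho c M x - profile rho c M y) <= Rabs (x - y).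
Proof.
  assert (H0 : forall u, Rabs (u - u) <= Rabs (x - y))
    by (intro u; rewrite Rminus_diag, Rabs_R0; apply Rabs_pos).
  unfold profile; apply Rmin_dist; [lra|].
  apply Rmax_dist.
  - replace (2 * rho - x - (2 * rho - y)) with (- (x - y)) by ring.
    rewrite Rabs_Ropp; lra.
  - apply Rmin_dist; [apply H0|]; apply Rmax_dist; [apply H0|].
    replace (x - M - c - (y - M - c)) with (x - y) by ring; lra.
Qed.

Lemma lipschitz_continuous (k : R) (g : R -> R) :
  (forall x y, Rabs (g x - g y) <= k * Rabs (x - y)) -> forall x, continuous g x.
Proof.
  intros Hg x; apply continuity_pt_filterlim; intros eps Heps.
  (* The [+ 1] keeps the radius chosen next positive and well defined even for [k = 0]. *)
  assert (Hk : 0 < Rabs k + 1) by (pose proof (Rabs_pos k); lra).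
  exists (eps / (Rabs k + 1)); split; [now apply Rdiv_lt_0_compat|].
  intros y [_ Hy]; simpl in Hy |- *; unfold R_dist in *.
  apply (Rmult_lt_compat_r _ _ _ Hk) in Hy.
  replace (eps / (Rabs k + 1) * (Rabs k + 1)) with eps in Hy by (field; lra).
  pose proof (Hg y x); pose proof (Rle_abs k); pose proof (Rabs_pos (y - x)); nra.
Qed.

Lemma profile_continuous (rho c M x : R) : continuous (profile rho c M) x.
Proof.
  apply (lipschitz_continuous 1); intros u v; rewrite Rmult_1_l.
  apply profile_lipschitz.
Qed.

Lemma profile_id (rho c M y : R) : 0 <= rho -> y <= rho -> profile rho c M y = y.
Proof.
  unfold profile, Rmin, Rmax; intros.
  repeat destruct Rle_dec; lra.
Qed.

Lemma profile_nonneg (rho c M y : R) : 0 <= y <= 2 * rho -> 0 <= profile rho c M y.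
Proof.
  unfold profile, Rmin, Rmax; intros.
  repeat destruct Rle_dec; lra.
Qed.

Lemma profile_ge (rho c M y : R) : 0 <= c -> 0 <= y -> - c <= profile rho c M y.
Proof.
  unfold profile, Rmin, Rmax; intros.
  repeat destruct Rle_dec; lra.
Qed.

Lemma profile_slope (rho c M y : R) :
  0 <= rho -> 0 <= c -> 2 * rho + c <= y <= M -> profile rho c M y = - c.
Proof.
  unfold profile, Rmin, Rmax; intros.
  repeat destruct Rle_dec; lra.
Qed.

Lemma profile_tail (rho c M y : R) :
  0 <= c -> 0 <= y -> M + c <= y -> 0 <= profile rho c M y.
Proof.
  unfold profile, Rmin, Rmax; intros.
  repeat destruct Rle_dec; lra.
Qed.

(** * The potential and its nonnegativity *)

Definition potential (rho c M x : R) : R := RInt (profile rho c M) 0 x.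

Lemma potential_derive (rho c M x : R) :
  is_derive (potential rho c M) x (profile rho c M x).
Proof.
  apply (is_derive_RInt (profile rho c M) _ 0); [|apply profile_continuous].
  apply filter_forall; intro y; apply (RInt_correct (profile rho c M) 0 y).
  apply ex_RInt_continuous; intros; apply profile_continuous.
Qed.

Lemma potential_quadratic (rho c M x : R) :
  0 <= rho -> x <= rho -> potential rho c M x = x ^ 2 / 2.
Proof.
  intros Hr Hx; unfold potential.
  rewrite (RInt_ext _ (fun y => y)).
  - apply is_RInt_unique.
    replace (x ^ 2 / 2) with (minus (x ^ 2 / 2) (0 ^ 2 / 2))
      by (unfold minus, plus, opp; simpl; field).
    apply (is_RInt_derive (fun y => y ^ 2 / 2) (fun y => y)).
    + intros y _; auto_derive; [easy|field].
    + intros y _; apply continuous_id.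
  - intros y [_ Hy]; apply profile_id; [easy|].
    revert Hy; unfold Rmax; destruct Rle_dec; lra.
Qed.

Lemma potential_increment (rho c M a b k : R) :
  a <= b -> (forall y, a <= y <= b -> k <= profile rho c M y) ->
  potential rho c M a + k * (b - a) <= potential rho c M b.
Proof.
  intros Hab Hk.
  destruct (MVT_gen (potential rho c M) a b (profile rho c M)) as [z [Hz Heq]].
  - intros; apply potential_derive.
  - intros y _; apply continuity_pt_filterlim.
    apply (ex_derive_continuous (potential rho c M)).
    eexists; apply potential_derive.
  - rewrite Rmin_left, Rmax_right in Hz by easy.
    specialize (Hk z Hz); nra.
Qed.

(** The potential is at least [rho ^ 2 / 2] on [[rho, 2 rho]]; the descent from [2 rho] to [M + c],
    at slope at least [- c], costs at most [c * (M + c - 2 * rho)]; nothing is lost beyond. The last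
    hypothesis is this budget. *)
Lemma potential_nonneg (rho c M x : R) :
  0 <= rho -> 0 <= c -> 2 * rho <= M -> c * (M + c - 2 * rho) <= rho ^ 2 / 2 ->
  0 <= potential rho c M x.
Proof.
  intros Hr Hc HM Hb.
  assert (H1 : potential rho c M rho = rho ^ 2 / 2)
    by (apply potential_quadratic; lra).
  destruct (Rle_dec x rho) as [Hx|Hx].
  { rewrite potential_quadratic by easy; nra. }
  assert (H2 : forall y, rho <= y <= 2 * rho -> rho ^ 2 / 2 <= potential rho c M y).
  { intros y Hy.
    pose proof (potential_increment rho c M rho y 0) as H.
    assert (potential rho c M rho + 0 * (y - rho) <= potential rho c M y)
      by (apply H; [lra|intros; apply profile_nonneg; lra]).
    lra. }
  destruct (Rle_dec x (2 * rho)) as [Hx2|Hx2].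
  { specialize (H2 x); nra. }
  specialize (H2 (2 * rho)).
  assert (H3 : forall y, 2 * rho <= y <= M + c -> 0 <= potential rho c M y).
  { intros y Hy.
    assert (potential rho c M (2 * rho) + - c * (y - 2 * rho) <= potential rho c M y)
      by (apply potential_increment; [lra|intros; apply profile_ge; lra]).
    nra. }
  destruct (Rle_dec x (M + c)) as [Hx3|Hx3]; [apply H3; lra|].
  specialize (H3 (M + c)).
  assert (potential rho c M (M + c) + 0 * (x - (M + c)) <= potential rho c M x)
    by (apply potential_increment; [lra|intros; apply profile_tail; lra]).
  lra.
Qed.

(** * Growth factor of the iterates on the quadratic part *)

(** With [a = eta l], this is [x_t / x_0] on the quadratic part, stripped of its sign [(-1)^t]. *)
Fixpoint amplification (a : R) (t : nat) : R :=
  match t with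
  | O => 1
  | S s => amplification a s * (a / sqrt (INR (s + 1)) - 1)
  end.

(** For a ratio [q], the constant 4 gives both [q - 1 >= 3], used for monotonicity, and
    [q - 1 >= 3 q / 4], used for the growth rate. *)
Lemma ratio_ge_4 (a : R) (s : nat) :
  0 < a -> 16 * INR (s + 1) <= a ^ 2 -> 4 <= a / sqrt (INR (s + 1)).
Proof.
  intros Ha H.
  assert (Hs : 0 < INR (s + 1)) by (apply lt_0_INR; lia).
  pose proof (sqrt_lt_R0 _ Hs); pose proof (sqrt_sqrt _ (Rlt_le _ _ Hs)).
  apply -> Rle_div_r; nra.
Qed.

Lemma amplification_monotone (a : R) (s t : nat) :
  0 < a -> 16 * INR t <= a ^ 2 -> (s <= t)%nat ->
  1 <= amplification a s <= amplification a t.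
Proof.
  intros Ha Ht Hst.
  assert (H1 : forall u, (u <= t)%nat -> 1 <= amplification a u).
  { induction u as [|u IH]; simpl; intro Hu; [lra|].
    assert (INR (u + 1) <= INR t) by (apply le_INR; lia).
    pose proof (ratio_ge_4 a u Ha ltac:(lra)).
    specialize (IH ltac:(lia)); nra. }
  split; [now apply H1|].
  revert Ht H1; induction Hst as [|t Hst IH]; intros Ht H1; [lra|].
  rewrite S_INR in Ht.
  assert (amplification a s <= amplification a t)
    by (apply IH; [lra|intros; apply H1; lia]).
  pose proof (H1 t ltac:(lia)).
  pose proof (ratio_ge_4 a t Ha ltac:(rewrite plus_INR; simpl; lra)).
  simpl; nra.
Qed.

(** Each squared factor satisfies [(q - 1)^2 >= 9 q^2 / 16], and the squared ratios [q^2] multiply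
    to [a^(2t) / t!]. *)
Lemma amplification_factorial (a : R) (t : nat) :
  0 < a -> 16 * INR t <= a ^ 2 ->
  (9 * a ^ 2 / 16) ^ t <= INR (fact t) * amplification a t ^ 2.
Proof.
  intros Ha; induction t as [|t IH]; intro Ht; [simpl; lra|].
  rewrite S_INR in Ht; specialize (IH ltac:(lra)).
  assert (E : INR (t + 1) = INR t + 1) by (rewrite plus_INR; reflexivity).
  pose proof (pos_INR t).
  pose proof (ratio_ge_4 a t Ha ltac:(rewrite E; lra)) as H4.
  set (q := a / sqrt (INR (t + 1))) in *.
  assert (Hs : 0 < INR (t + 1)) by lra.
  assert (Hq : INR (t + 1) * q ^ 2 = a ^ 2).
  { unfold q; pose proof (sqrt_lt_R0 _ Hs).
    rewrite <- (pow2_sqrt (INR (t + 1))) at 1 by lra; field; lra. }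
  change (fact (S t)) with (S t * fact t)%nat.
  rewrite mult_INR, S_INR, <- E.
  change (amplification a (S t)) with (amplification a t * (q - 1)).
  change ((9 * a ^ 2 / 16) ^ S t) with (9 * a ^ 2 / 16 * (9 * a ^ 2 / 16) ^ t).
  replace (INR (t + 1) * INR (fact t) * (amplification a t * (q - 1)) ^ 2)
    with (INR (t + 1) * (q - 1) ^ 2 * (INR (fact t) * amplification a t ^ 2)) by ring.
  apply Rmult_le_compat; [nra|apply pow_le; nra| |exact IH].
  rewrite <- Hq; nra.
Qed.

(** * Stirling-type bounds and exponential growth *)

(** This is [(1 + 1/n)^(n+1) >= e], obtained by raising [1 - 1/(n+1) <= exp (- 1/(n+1))] to the
    power [n + 1]. *)
Lemma exp_1_le_ratio_pow (n : nat) : (1 <= n)%nat ->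
  exp 1 * INR n ^ S n <= INR (S n) ^ S n.
Proof.
  intro Hn.
  assert (0 < INR n) by (apply lt_0_INR; lia).
  assert (Hp : 0 < INR (S n)) by (apply lt_0_INR; lia).
  assert (H1 : INR n / INR (S n) <= exp (- / INR (S n))).
  { pose proof (exp_ineq1_le (- / INR (S n))).
    replace (INR n / INR (S n)) with (1 + - / INR (S n)); [easy|].
    rewrite S_INR in *; field; lra. }
  assert (H2 : INR n <= exp (- / INR (S n)) * INR (S n)).
  { apply Rle_div_l in H1; lra. }
  assert (H3 : exp (- / INR (S n)) ^ S n = exp (- (1))).
  { rewrite <- Rpower_pow by apply exp_pos.
    unfold Rpower; rewrite ln_exp; f_equal; field; lra. }
  assert (H4 : INR n ^ S n <= exp (- (1)) * INR (S n) ^ S n).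
  { rewrite <- H3, <- Rpow_mult_distr; apply pow_incr; lra. }
  apply (Rmult_le_compat_l (exp 1)) in H4; [|left; apply exp_pos].
  rewrite <- Rmult_assoc, <- exp_plus, Rplus_opp_r, exp_0, Rmult_1_l in H4.
  exact H4.
Qed.

(** A weak Stirling bound, [t! <= e t (t/e)^t], cleared of division; the preceding inequality is
    what its induction step needs. *)
Lemma factorial_upper (t : nat) : (1 <= t)%nat ->
  INR (fact t) * exp 1 ^ t <= exp 1 * INR t ^ S t.
Proof.
  induction 1 as [|t Ht IH]; [simpl; lra|].
  change (fact (S t)) with (S t * fact t)%nat; rewrite mult_INR.
  pose proof (exp_1_le_ratio_pow t Ht) as H1.
  pose proof (exp_pos 1); pose proof (pos_INR (S t)).
  replace (INR (S t) * INR (fact t) * exp 1 ^ S t)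
    with (INR (S t) * exp 1 * (INR (fact t) * exp 1 ^ t)) by (simpl; ring).
  apply Rle_trans with (INR (S t) * exp 1 * (exp 1 * INR t ^ S t)).
  - apply Rmult_le_compat_l; [nra|easy].
  - replace (exp 1 * INR (S t) ^ S (S t))
      with (INR (S t) * exp 1 * INR (S t) ^ S t) by (simpl; ring).
    apply Rmult_le_compat_l; [nra|easy].
Qed.

Lemma bernoulli (x : R) (n : nat) : 0 <= x -> 1 + INR n * x <= (1 + x) ^ n.
Proof.
  intro Hx; induction n as [|n IH]; [simpl; lra|].
  rewrite S_INR; simpl; pose proof (pos_INR n); nra.
Qed.

(** The factorial bounds give [amplification a t ^ 2 >= 2 (9e)^t / (e t)]. Lowering the base from 9
    to 8 gains a factor [sqrt t / 2], and [e <= 3] produces the constant 3. *)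
Lemma amplification_growth (a : R) (t : nat) :
  0 < a -> (1 <= t)%nat -> 16 * INR (t + 1) <= a ^ 2 ->
  (8 * exp 1) ^ t <= 3 * sqrt (INR t) * amplification a t ^ 2.
Proof.
  intros Ha Ht Hat.
  rewrite plus_INR in Hat; simpl (INR 1) in Hat.
  assert (Hp : 1 <= INR t) by (apply (le_INR 1); easy).
  assert (Hf : 0 < INR (fact t)) by apply INR_fact_lt_0.
  pose proof (amplification_factorial a t Ha ltac:(lra)) as H1.
  pose proof (factorial_upper t Ht) as H2.
  set (s := sqrt (INR t)).
  assert (Hss : s * s = INR t) by (apply sqrt_sqrt; lra).
  assert (Hs : 0 < s) by (apply sqrt_lt_R0; lra).
  assert (H3 : (9 * (INR t + 1)) ^ t <= INR (fact t) * amplification a t ^ 2).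
  { eapply Rle_trans; [apply pow_incr|exact H1]; lra. }
  (* Bernoulli at [1/t] yields [(1 + 1/t)^t >= 2]. *)
  assert (H4 : 2 * INR t ^ t <= (INR t + 1) ^ t).
  { pose proof (bernoulli (/ INR t) t ltac:(left; apply Rinv_0_lt_compat; lra)) as H.
    rewrite Rinv_r in H by lra.
    apply (Rmult_le_compat_r (INR t ^ t)) in H; [|apply pow_le; lra].
    rewrite <- Rpow_mult_distr in H.
    replace ((1 + / INR t) * INR t) with (INR t + 1) in H by (field; lra).
    lra. }
  assert (H5 : s * 8 ^ t <= 2 * 9 ^ t).
  (* Squared, this reads [t <= 4 (81/64)^t], which follows from Bernoulli since [4 * 17/64 > 1]. *)
  { assert (Hb : s <= 2 * (9 / 8) ^ t).
    { apply Rsqr_incr_0_var; [|pose proof (pow_lt (9 / 8) t); lra].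
      unfold Rsqr; rewrite Hss.
      replace (2 * (9 / 8) ^ t * (2 * (9 / 8) ^ t))
        with (4 * ((9 / 8) * (9 / 8)) ^ t) by (rewrite Rpow_mult_distr; ring).
      pose proof (bernoulli (17 / 64) t ltac:(lra)) as H.
      replace (9 / 8 * (9 / 8)) with (1 + 17 / 64) by field.
      lra. }
    apply (Rmult_le_compat_r (8 ^ t)) in Hb; [|apply pow_le; lra].
    rewrite Rmult_assoc, <- Rpow_mult_distr in Hb.
    replace (9 / 8 * 8) with 9 in Hb by field; exact Hb. }
  apply (Rmult_le_reg_l (INR (fact t))); [easy|].
  replace (INR (fact t) * (3 * s * amplification a t ^ 2))
    with (3 * s * (INR (fact t) * amplification a t ^ 2)) by ring.
  apply Rle_trans with (3 * s * (9 * (INR t + 1)) ^ t);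
    [|apply Rmult_le_compat_l; lra].
  rewrite !Rpow_mult_distr.
  pose proof exp_le_3 as He.
  assert (P8 : 0 < 8 ^ t) by (apply pow_lt; lra).
  assert (P9 : 0 < 9 ^ t) by (apply pow_lt; lra).
  assert (Pt : 0 < INR t ^ t) by (apply pow_lt; lra).
  apply Rle_trans with (8 ^ t * (3 * INR t ^ S t)).
  { replace (INR (fact t) * (8 ^ t * exp 1 ^ t))
      with (8 ^ t * (INR (fact t) * exp 1 ^ t)) by ring.
    apply Rmult_le_compat_l; [lra|].
    eapply Rle_trans; [exact H2|].
    apply Rmult_le_compat_r; [apply pow_le; lra|easy]. }
  change (INR t ^ S t) with (INR t * INR t ^ t); rewrite <- Hss at 1.
  replace (8 ^ t * (3 * (s * s * INR t ^ t)))
    with (3 * s * (s * 8 ^ t * INR t ^ t)) by ring.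
  apply Rmult_le_compat_l; [lra|].
  apply Rle_trans with (2 * 9 ^ t * INR t ^ t).
  - apply Rmult_le_compat_r; lra.
  - nra.
Qed.

(** * The switching time and the growth reached there *)

Lemma threshold_bounds (eta l : R) : 4 <= eta * l ->
  16 * INR (threshold eta l + 1) <= (eta * l) ^ 2 < 16 * INR (threshold eta l + 2).
Proof.
  intro H; unfold threshold.
  replace (eta ^ 2 * l ^ 2) with ((eta * l) ^ 2) by ring.
  set (y := (eta * l) ^ 2 / 16 - 1).
  assert (Hy : 0 <= y) by (unfold y; nra).
  destruct (base_Int_part y) as [H1 H2].
  (* Nonnegativity of the floor ensures that [Z.to_nat] does not truncate it. *)
  assert (Hz : (0 <= Int_part y)%Z).
  { apply Zlt_succ_le, lt_IZR; rewrite succ_IZR; lra. }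
  rewrite !plus_INR, INR_IZR_INZ, Z2Nat.id by easy; simpl.
  unfold y in *; lra.
Qed.

Lemma Rpower_half_sq (b p : R) : Rpower b (p / 2) ^ 2 = Rpower b p.
Proof.
  simpl; rewrite Rmult_1_r, <- Rpower_plus; f_equal; field.
Qed.

Lemma sqrt_mul_Rpower_half_le (A b p g : R) : 0 <= A ->
  A * Rpower b p <= g ^ 2 -> sqrt A * Rpower b (p / 2) <= Rabs g.
Proof.
  intros HA H.
  apply Rsqr_incr_0_var; [|apply Rabs_pos].
  rewrite <- Rsqr_abs, !Rsqr_pow2, Rpow_mult_distr, pow2_sqrt, Rpower_half_sq; easy.
Qed.

(** The upper bound on [a ^ 2] gives [n > a^2/16 - 2], so the power is at most [(8e)^n]; the lower
    bound gives [3 sqrt n <= 3a/4], the source of [4 / (3a)]. *)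
Lemma amplification_at_threshold (a : R) (n : nat) :
  5 <= a -> 16 * INR (n + 1) <= a ^ 2 < 16 * INR (n + 2) ->
  4 / (3 * a) * Rpower (8 * exp 1) (a ^ 2 / 16 - 2) <= amplification a n ^ 2.
Proof.
  intros Ha [H1 H2].
  pose proof (exp_ineq1_le 1) as He.
  assert (Hn : Rpower (8 * exp 1) (a ^ 2 / 16 - 2) <= (8 * exp 1) ^ n).
  { rewrite <- (Rpower_pow n) by lra; apply Rle_Rpower; [lra|].
    rewrite plus_INR in H2; simpl in H2; lra. }
  assert (Hc : 0 < 4 / (3 * a)) by (apply Rdiv_lt_0_compat; lra).
  (* The growth estimate starts at [t = 1]. For [n = 0] the power is at most 1, and [a >= 5] makes
     the prefactor at most 1. *)
  destruct (Nat.eq_dec n 0) as [->|Hn0].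
  - simpl in *.
    assert (4 / (3 * a) <= 1) by (apply Rle_div_l; lra).
    nra.
  - pose proof (amplification_growth a n ltac:(lra) ltac:(lia) H1) as HG.
    assert (Hs : 4 * sqrt (INR n) <= a).
    { apply Rsqr_incr_0_var; [|lra]; unfold Rsqr.
      pose proof (sqrt_sqrt (INR n) (pos_INR n)).
      rewrite plus_INR in H1; simpl in H1; nra. }
    apply Rle_trans with (4 / (3 * a) * (3 * sqrt (INR n) * amplification a n ^ 2)).
    + apply Rmult_le_compat_l; lra.
    + replace (4 / (3 * a) * (3 * sqrt (INR n) * amplification a n ^ 2))
        with (4 * sqrt (INR n) / a * amplification a n ^ 2) by (field; lra).
      rewrite <- (Rmult_1_l (amplification a n ^ 2)) at 2.
      apply Rmult_le_compat_r; [apply pow2_ge_0|].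
      apply Rle_div_l; lra.
Qed.

(** * Gradient descent on the quadratic part and on the slope *)

(** The right side equals [2 / (sqrt (t+1) + sqrt t)]; it telescopes when the steps on the slope are
    summed. *)
Lemma inv_sqrt_le (t : nat) :
  / sqrt (INR (t + 1)) <= 2 * (sqrt (INR (t + 1)) - sqrt (INR t)).
Proof.
  assert (E : INR (t + 1) = INR t + 1) by (rewrite plus_INR; reflexivity).
  pose proof (pos_INR t) as Ht.
  assert (Hs : 0 < sqrt (INR (t + 1))) by (apply sqrt_lt_R0; lra).
  pose proof (sqrt_sqrt (INR t) Ht).
  pose proof (sqrt_sqrt (INR (t + 1)) ltac:(lra)).
  apply (Rmult_le_reg_r _ _ _ Hs); rewrite Rinv_l by lra.
  nra.
Qed.

(** Each step contributes a sign -1, so the initial sign [(-1)^(n+1)] makes the [n]-th iterate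
    [- r * amplification (eta * l) n]. The bound by [rho] is carried through the induction to keep
    the linear formula for the derivative applicable. *)
Lemma growth_phase (eta l r rho : R) (n : nat) (f : R -> R) :
  0 < eta * l -> 0 <= r -> 16 * INR n <= (eta * l) ^ 2 ->
  r * amplification (eta * l) n <= rho ->
  (forall y, y <= rho -> Derive f y = l * y) ->
  forall t, (t <= n)%nat ->
  gradient_descent f (fun t => eta / sqrt (INR (t + 1))) ((-1) ^ (n + 1) * r) t
    = (-1) ^ (n + 1 + t) * (r * amplification (eta * l) t)
  /\ gradient_descent f (fun t => eta / sqrt (INR (t + 1))) ((-1) ^ (n + 1) * r) t
     <= rho.
Proof.
  intros Ha Hr Hn Hrho Hf.
  assert (Hle : forall t, (t <= n)%nat ->
    (-1) ^ (n + 1 + t) * (r * amplification (eta * l) t) <= rho).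
  { intros t Ht.
    pose proof (amplification_monotone _ t n Ha Hn Ht) as Hm.
    eapply Rle_trans; [apply Rle_abs|].
    rewrite Rabs_mult, pow_1_abs, Rmult_1_l, Rabs_pos_eq by nra; nra. }
  induction t as [|t IH]; intro Ht.
  - pose proof (Hle 0%nat Ht) as H; simpl in *.
    rewrite Nat.add_0_r, Rmult_1_r in *; split; [reflexivity|exact H].
  - destruct (IH ltac:(lia)) as [E H].
    assert (E' : gradient_descent f (fun t => eta / sqrt (INR (t + 1)))
        ((-1) ^ (n + 1) * r) (S t)
        = (-1) ^ (n + 1 + S t) * (r * amplification (eta * l) (S t))).
    { simpl; rewrite Hf by exact H; rewrite E.
      replace (n + 1 + S t)%nat with (S (n + 1 + t)) by lia; simpl; field.
      apply Rgt_not_eq, sqrt_lt_R0, lt_0_INR; lia. }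
    split; [exact E'|rewrite E'; apply Hle, Ht].
Qed.

(** A step on the slope moves right by [c (eta l) / sqrt (t+1)], for a total of at most
    [2 c (eta l) sqrt T], so [M] is not passed; on the left, [c <= rho] gives
    [2 rho + c <= 3 rho]. *)
Lemma plateau_phase (eta l c rho M x0 : R) (n T : nat) (f : R -> R) :
  0 <= eta * l -> 0 <= c <= rho ->
  5 * rho + 2 * c * (eta * l) * sqrt (INR T) <= M ->
  (forall y, 2 * rho + c <= y <= M -> Derive f y = - (l * c)) ->
  let x := gradient_descent f (fun t => eta / sqrt (INR (t + 1))) x0 in
  3 * rho <= x (n + 1)%nat <= 5 * rho ->
  forall t, (n < t <= T)%nat -> Derive f (x t) = - (l * c).
Proof.
  intros Ha Hc HM Hf x Hx.
  assert (Hin : forall t y, (t <= T)%nat ->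
      3 * rho <= y <= 5 * rho + 2 * c * (eta * l) * sqrt (INR t) ->
      Derive f y = - (l * c)).
  { intros t y Ht Hy; apply Hf.
    pose proof (sqrt_le_1 _ _ (pos_INR t) (pos_INR T) (le_INR _ _ Ht)).
    assert (0 <= c * (eta * l)) by nra.
    split; [lra|nra]. }
  (* The upper bound grows with [sqrt (INR t)], which leaves room for exactly one more step in the
     induction. *)
  assert (Hpos : forall t, (n < t)%nat -> (t <= T)%nat ->
      3 * rho <= x t <= 5 * rho + 2 * c * (eta * l) * sqrt (INR t)).
  { assert (Hca : 0 <= c * (eta * l)) by nra.
    intros t Hnt; induction Hnt as [|t Hnt IH]; intro Ht.
    - replace (S n) with (n + 1)%nat by lia.
      pose proof (sqrt_pos (INR (n + 1))); nra.
    - specialize (IH ltac:(lia)).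
      pose proof (Hin t (x t) ltac:(lia) IH) as HD.
      change (x (S t)) with (x t - eta / sqrt (INR (t + 1)) * Derive f (x t)).
      rewrite HD.
      replace (x t - eta / sqrt (INR (t + 1)) * - (l * c))
        with (x t + c * (eta * l) * / sqrt (INR (t + 1))) by (unfold Rdiv; ring).
      replace (S t) with (t + 1)%nat by lia.
      pose proof (inv_sqrt_le t).
      assert (0 < / sqrt (INR (t + 1)))
        by (apply Rinv_0_lt_compat, sqrt_lt_R0, lt_0_INR; lia).
      nra. }
  intros t [H1 H2]; apply (Hin t); auto.
Qed.

(** * The hard function and the verification of each bound *)

Theorem theorem2 (T : nat) (eta l Delta : R)
  (hT : (1 <= T)%nat) (heta : 0 < eta) (hl : 0 < l) (hDelta : 0 < Delta)
  (hetal : 5 <= eta * l) :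
  exists (f : R -> R) (fstar x0 : R),
    smooth l f /\
    is_min_value f fstar /\
    f x0 - fstar <= Delta /\
    let x := gradient_descent f (fun t => eta / sqrt (INR (t + 1))) x0 in
    let t0 := threshold eta l in
    (forall t : nat, (1 <= t <= t0)%nat ->
       Rabs (Derive f (x t)) >=
         sqrt (2 * l * Delta / (3 * sqrt (INR t)))
         * Rpower (8 * exp 1) (INR t / 2)) /\
    Rabs (Derive f (x t0)) >=
      sqrt (8 * Delta / (3 * eta))
      * Rpower (8 * exp 1) (eta ^ 2 * l ^ 2 / 32 - 4) /\
    ((t0 < T)%nat ->
     exists Dtilde : R,
       Dtilde >= 4 / (3 * eta * l)
                 * Rpower (8 * exp 1) (eta ^ 2 * l ^ 2 / 16 - 2) * Delta /\
       (forall t : nat, (t0 < t <= T)%nat ->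
          Rabs (Derive f (x t)) >=
            1 / 4 * sqrt Dtilde
            * Rmin (Rpower l (1 / 2))
                   (Rpower (2 * eta) (- (1 / 2)) * Rpower (INR T) (- (1 / 4))))).
Proof.
  set (a := eta * l) in *.
  pose proof (threshold_bounds eta l ltac:(fold a; lra)) as Hn.
  set (n := threshold eta l) in *; fold a in Hn.
  (* With this radius [l * r ^ 2 / 2 = Delta], so the initial gap is exactly [Delta]. *)
  set (r := sqrt (2 * Delta / l)).
  assert (Hr2 : r ^ 2 = 2 * Delta / l)
    by (apply pow2_sqrt; left; apply Rdiv_lt_0_compat; lra).
  assert (Hr : 0 < r) by (apply sqrt_lt_R0, Rdiv_lt_0_compat; lra).
  assert (Hn1 : 16 * INR n <= a ^ 2)
    by (rewrite plus_INR in Hn; simpl in Hn; lra).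
  pose proof (amplification_at_threshold a n hetal Hn) as HG.
  set (rho := r * amplification a n).
  assert (Hu : 1 <= amplification a n)
    by (apply (amplification_monotone a n n); [lra|easy|lia]).
  assert (Hrho : r <= rho) by (unfold rho; nra).
  assert (HT : 1 <= INR T) by (apply (le_INR 1); easy).
  set (w := sqrt (INR T)).
  assert (Hw : 1 <= w) by (rewrite <- sqrt_1; apply sqrt_le_1; lra).
  (* The 8 turns the final gradient bound into an equality and still keeps the drop along the slope
     within budget. *)
  set (c := rho / (8 * sqrt (a * w))).
  assert (Haw : 5 <= a * w) by nra.
  assert (Hc : 0 < c).
  { apply Rdiv_lt_0_compat; [lra|]; pose proof (sqrt_lt_R0 (a * w)); lra. }
  assert (Hc2 : c ^ 2 * (a * w) = rho ^ 2 / 64).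
  { unfold c; rewrite <- (pow2_sqrt (a * w)) at 2 by lra.
    field; apply Rgt_not_eq, sqrt_lt_R0; lra. }
  assert (Hc16 : 16 * c <= rho) by (apply Rsqr_incr_0_var; unfold Rsqr; nra).
  set (M := 5 * rho + 2 * c * a * w).
  assert (HM : 5 * rho <= M) by (unfold M; nra).
  set (f := fun x => l * potential rho c M x).
  assert (Hd : forall y, is_derive f y (l * profile rho c M y))
    by (intro; apply is_derive_scal, potential_derive).
  assert (HD : forall y, Derive f y = l * profile rho c M y)
    by (intro; apply is_derive_unique, Hd).
  set (x0 := (-1) ^ (n + 1) * r).
  assert (Hgrow := growth_phase eta l r rho n f ltac:(fold a; lra) ltac:(lra) Hn1
    (Rle_refl _) ltac:(intros; rewrite HD, profile_id by lra; reflexivity)).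
  fold a x0 in Hgrow.
  set (x := gradient_descent f (fun t => eta / sqrt (INR (t + 1))) x0) in *.
  assert (Hsq : forall t, (t <= n)%nat ->
    Derive f (x t) ^ 2 = 2 * l * Delta * amplification a t ^ 2).
  { intros t Ht; destruct (Hgrow t Ht) as [E Hle].
    rewrite HD, profile_id by lra; rewrite E.
    replace ((l * ((-1) ^ (n + 1 + t) * (r * amplification a t))) ^ 2)
      with (l ^ 2 * r ^ 2 * amplification a t ^ 2 * ((-1) ^ (n + 1 + t)) ^ 2) by ring.
    rewrite Hr2, <- pow_mult, Nat.mul_comm, pow_1_even; field; lra. }
  assert (Hxn : x (n + 1)%nat = (a / sqrt (INR (n + 1)) - 1) * rho).
  { destruct (Hgrow n (le_n n)) as [E Hle].
    (* The exponent is odd, so [x n = - rho] and the next step overshoots to the positive side. *)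
    replace (n + 1 + n)%nat with (S (2 * n)) in E by lia.
    rewrite pow_1_odd in E; fold rho in E.
    rewrite Nat.add_1_r at 1.
    change (x (S n)) with (x n - eta / sqrt (INR (n + 1)) * Derive f (x n)).
    rewrite HD, profile_id by lra; rewrite E; unfold a.
    field; apply Rgt_not_eq, sqrt_lt_R0, lt_0_INR; lia. }
  assert (Hxn35 : 3 * rho <= x (n + 1)%nat <= 5 * rho).
  { rewrite Hxn; pose proof (ratio_ge_4 a n ltac:(lra) ltac:(lra)).
    (* By maximality of [n], [a^2 < 16 (n+2) <= 36 (n+1)]. *)
    assert (a / sqrt (INR (n + 1)) <= 6).
    { assert (Hp : 0 < INR (n + 1)) by (apply lt_0_INR; lia).
      pose proof (sqrt_lt_R0 _ Hp); pose proof (sqrt_sqrt _ (Rlt_le _ _ Hp)).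
      apply Rle_div_l; [lra|].
      rewrite !plus_INR in *; simpl (INR 1) in *; simpl (INR 2) in *.
      pose proof (pos_INR n).
      apply Rsqr_incr_0_var; unfold Rsqr; nra. }
    nra. }
  exists f, 0, x0; split; [|split; [|split; [|split; [|split]]]].
  - split; [intro y; eexists; apply Hd|].
    intros y z; rewrite !HD, <- Rmult_minus_distr_l, Rabs_mult, (Rabs_pos_eq l) by lra.
    apply Rmult_le_compat_l; [lra|apply profile_lipschitz].
  - split.
    + exists 0; unfold f; rewrite potential_quadratic by lra; field.
    + intro y; apply Rmult_le_pos; [lra|]; apply potential_nonneg; try lra.
      (* The drop is [3 c rho + c^2 + 2 c^2 a w]; with [c <= rho / 16] and [c^2 a w = rho^2 / 64] it
         stays below [rho^2 / 4]. *)
      unfold M; nra.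
  - unfold f; rewrite potential_quadratic.
    + unfold x0; rewrite Rpow_mult_distr, <- pow_mult, Nat.mul_comm, pow_1_even, Hr2.
      right; field; lra.
    + lra.
    + exact (proj2 (Hgrow 0%nat ltac:(lia))).
  - intros t [Ht1 Htn]; apply Rle_ge.
    assert (Hst : 0 < sqrt (INR t)) by (apply sqrt_lt_R0, lt_0_INR; lia).
    apply sqrt_mul_Rpower_half_le.
    + left; apply Rdiv_lt_0_compat; nra.
    + rewrite Hsq, Rpower_pow by (easy || (pose proof (exp_pos 1); lra)).
      assert (16 * INR (t + 1) <= a ^ 2).
      { assert (INR (t + 1) <= INR (n + 1)) by (apply le_INR; lia); lra. }
      pose proof (amplification_growth a t ltac:(lra) Ht1 ltac:(easy)).
      replace (2 * l * Delta / (3 * sqrt (INR t)) * (8 * exp 1) ^ t)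
        with (2 * l * Delta * ((8 * exp 1) ^ t / (3 * sqrt (INR t)))) by (field; lra).
      apply Rmult_le_compat_l; [nra|]; apply Rle_div_l; lra.
  - apply Rle_ge.
    replace (eta ^ 2 * l ^ 2 / 32 - 4) with ((a ^ 2 / 16 - 8) / 2)
      by (unfold a; field).
    apply sqrt_mul_Rpower_half_le.
    + left; apply Rdiv_lt_0_compat; lra.
    + rewrite Hsq by lia.
      (* Squaring doubles the claimed exponent to [a^2/16 - 8], which is weaker than the
         [a^2/16 - 2] in [HG]. *)
      assert (Rpower (8 * exp 1) (a ^ 2 / 16 - 8)
              <= Rpower (8 * exp 1) (a ^ 2 / 16 - 2)).
      { apply Rle_Rpower; [pose proof (exp_ineq1_le 1)|]; lra. }
      replace (8 * Delta / (3 * eta)) with (2 * l * Delta * (4 / (3 * a)))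
        by (unfold a; field; lra).
      rewrite Rmult_assoc; apply Rmult_le_compat_l; [nra|].
      eapply Rle_trans; [|exact HG]; apply Rmult_le_compat_l; [|easy].
      left; apply Rdiv_lt_0_compat; lra.
  (* The witness is the gap at the switching time, [f (x n) = f (- rho)]. *)
  - intros HnT; exists (l * rho ^ 2 / 2); split.
    + apply Rle_ge.
      replace (l * rho ^ 2 / 2) with (amplification a n ^ 2 * Delta)
        by (unfold rho; rewrite Rpow_mult_distr, Hr2; field; lra).
      apply Rmult_le_compat_r; [lra|].
      replace (eta ^ 2 * l ^ 2) with (a ^ 2) by (unfold a; ring).
      rewrite Rmult_assoc; exact HG.
    + intros t Ht; fold x; apply Rle_ge.
      assert (HDt : Derive f (x t) = - (l * c)).
      { apply (plateau_phase eta l c rho M x0 n T f); fold a.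
        - lra.
        - lra.
        - unfold M, w; lra.
        - intros y Hy; rewrite HD, profile_slope by lra; ring.
        - exact Hxn35.
        - exact Ht. }
      rewrite HDt, Rabs_Ropp, Rabs_pos_eq by (apply Rmult_le_pos; lra).
      (* The slope is calibrated to the entry of the minimum that depends on [T]. *)
      eapply Rle_trans.
      { apply Rmult_le_compat_l; [|apply Rmin_r].
        pose proof (sqrt_pos (l * rho ^ 2 / 2)); lra. }
      apply Rsqr_incr_0_var; [|nra].
      rewrite !Rsqr_pow2, !Rpow_mult_distr, pow2_sqrt by nra.
      replace (- (1 / 2)) with ((- (1)) / 2) by field.
      replace (- (1 / 4)) with ((- (/ 2)) / 2) by field.
      rewrite !Rpower_half_sq, !Rpower_Ropp, Rpower_1, Rpower_sqrt by lra.
      fold w.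
      (* Both squares equal [l rho^2 / (64 eta w)]. *)
      right; apply (Rmult_eq_reg_r (a * w)); [|lra].
      replace (l ^ 2 * c ^ 2 * (a * w)) with (l ^ 2 * (c ^ 2 * (a * w))) by ring.
      rewrite Hc2; unfold a; field; lra.
Qed.
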